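(* Let $q>0$, $q\ne 1$, and $y>0$. Let $f:(0,\infty)\to(0,\infty)$ satisfy (i) $f(x+1)=\dfrac{1-q^x}{1-q^{x+y}}\,f(x)$ for all $x>0$; (ii) for some $M\ge 0$, $f$ is logarithmically convex on $(M,\infty)$ (i.e. $\log f$ is convex there); (iii) $f(1)=\dfrac{1-q}{1-q^y}$. Then $f(x)=B_q(x,y)$ for all $x>0$.
   Context: The $q$-beta function is $B_q(x,y)=\frac{\Gamma_q(x)\Gamma_q(y)}{\Gamma_q(x+y)}$ for $x,y>0$. Here, with $(a;t)_\infty=\prod_{k=0}^\infty(1-at^k)$ for $0<t<1$: for $0<q<1$, $\Gamma_q(x)=\frac{(q;q)_\infty}{(q^x;q)_\infty}(1-q)^{1-x}$; for $q>1$, $\Gamma_q(x)=\frac{(q^{-1};q^{-1})_\infty}{(q^{-x};q^{-1})_\infty}(q-1)^{1-x}q^{\frac{x(x-1)}{2}}$. *)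

(* Defs.v *)
From HB Require Import structures.
From mathcomp Require Import all_boot all_order all_algebra.
From mathcomp Require Import all_classical all_reals all_analysis.

Set Implicit Arguments.
Unset Strict Implicit.
Unset Printing Implicit Defensive.

Import Order.TTheory GRing.Theory Num.Theory.
Import numFieldNormedType.Exports.

Local Open Scope classical_set_scope.
Local Open Scope ring_scope.

(* The infinite product (a; t)_oo; the partial products converge for
   0 < t < 1, the only range in which it is used below. *)
Definition qPochhammer (R : realType) (a t : R) : R :=
  limn (fun n : nat => \prod_(0 <= k < n) (1 - a * t ^+ k)).

(* Meant for q > 0, q != 1; the value at q = 1 is irrelevant. *)
Definition qGamma (R : realType) (q x : R) : R :=
  if q < 1 then
    qPochhammer q q / qPochhammer (q `^ x) q * (1 - q) `^ (1 - x)
  else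
    qPochhammer q^-1 q^-1 / qPochhammer (q `^ (- x)) q^-1
      * (q - 1) `^ (1 - x) * q `^ (x * (x - 1) / 2).

Definition qBeta (R : realType) (q x y : R) : R :=
  qGamma q x * qGamma q y / qGamma q (x + y).

(* Only the values of f on D matter: for an interval D, this says that log f
   is convex on D (f is assumed positive on D wherever this is used). *)
Definition log_convex_on (R : realType) (D : set R) (f : R -> R) : Prop :=
  @convex_function R R^o D (fun x => ln (f x)).

(* Main.v *)
Require Import Defs.
From HB Require Import structures.
From mathcomp Require Import all_boot all_order all_algebra.
From mathcomp Require Import all_classical all_reals all_analysis.
From mathcomp Require Import ring lra.

Import Order.TTheory GRing.Theory Num.Theory.
Import numFieldNormedType.Exports.

Local Open Scope classical_set_scope.
Local Open Scope ring_scope.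

(* Let h > 0 be log-convex near infinity and satisfy the recursion for a base
   0 < p < 1.  Since h (n + 1) / h n tends to 1, comparing chord slopes of ln h
   gives h (n + x) / h n --> 1 for every x > 0.  Iterating the recursion turns
   h (n + x) / h (n + 1) into h x / h 1 times a quotient of partial q-Pochhammer
   products, and n --> oo determines h x from h 1.  For q < 1 take h = f; for
   q > 1 take p = 1 / q and h x = f x * q ^ (x y), which stays log-convex because
   a linear function is added to the logarithm. *)

(** * Chord slopes of convex functions, and log-convexity *)

Section Slopes.
Context {R : realType} {M : R} {g : R -> R}.
Hypothesis g_convex : @convex_function R R^o [set x : R | M < x] g.

(** The point [b] is the convex combination of [a] and [c] with weight [(c - b) / (c - a)] on [a];
    multiplying by [c - a] clears the denominators. *)
Lemma convex_chord (a b c : R) : M < a -> a < b -> b < c ->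
  (c - a) * g b <= (c - b) * g a + (b - a) * g c.
Proof.
move=> Ma ab bc; have ca0 : 0 < c - a by lra.
have ca_neq0 : c - a != 0 by rewrite gt_eqF.
pose s := (c - b) / (c - a).
have s0 : 0 <= s by rewrite divr_ge0//; lra.
have s1 : s <= 1 by rewrite ler_pdivrMr//; lra.
have aD : a \in [set x : R | M < x] by rewrite inE.
have cD : c \in [set x : R | M < x] by rewrite inE /=; lra.
have := g_convex (Itv01 s0 s1) a c aD cD.
have -> : conv (Itv01 s0 s1) (a : convex_lmodType R^o) c = b.
  by change (s * a + (1 - s) * c = b); rewrite /s; field.
rewrite convRE /= /unstable.onem =>  /(ler_wpM2l (ltW ca0)) /le_trans; apply.
by rewrite le_eqVlt; apply/orP; left; apply/eqP; rewrite /s; field.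
Qed.

Lemma convex_slope_le (a b c : R) : M < a -> a < b -> b < c ->
  (g b - g a) / (b - a) <= (g c - g b) / (c - b).
Proof.
move=> Ma ab bc; have := convex_chord a b c Ma ab bc.
rewrite ler_pdivrMr ?subr_gt0// mulrAC ler_pdivlMr ?subr_gt0//.
by move=> ?; nra.
Qed.

End Slopes.

Lemma log_convex_on_mul_powR {R : realType} {M a : R} (c : R) {f : R -> R} :
  0 < a -> (forall x, M < x -> 0 < f x) ->
  log_convex_on [set x : R | M < x] f ->
  log_convex_on [set x : R | M < x] (fun x => f x * a `^ (c * x)).
Proof.
move=> a0 f0 fc t x z; rewrite !inE /= => Mx Mz.
have convE : conv t x z = t%:num * x + (1 - t%:num) * z by [].
(* The logarithm of the product splits only where [f] is positive, so the combination must be seen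
   to stay beyond [M]. *)
have Mxz : M < conv t x z.
  have /andP[t0 t1] : 0 <= t%:num <= 1 by rewrite ge0 le1.
  rewrite convE; have [->|] := eqVneq t%:num 1; first lra.
  move=> tn1; have {tn1} : t%:num < 1 by rewrite lt_neqAle tn1.
  by nra.
have lnE u : M < u -> ln (f u * a `^ (c * u)) = ln (f u) + c * u * ln a.
  by move=> Mu; rewrite lnM ?posrE ?powR_gt0// ?f0// ln_powR.
rewrite !lnE// convRE convE /= /unstable.onem.
have := fc t x z; rewrite !inE /= => /(_ Mx Mz).
by rewrite convE convRE /= /unstable.onem; lra.
Qed.

(** The slope of [ln h] on [[n + 1, n + 1 + x]] lies between its slopes on two unit chords with
    integer endpoints, one to the left and one far enough to the right. Both are increments [d],
    which tend to 0. *)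
Lemma log_convex_ratio_cvg1 {R : realType} {M : R} {h : R -> R} : 0 <= M ->
  (forall x : R, 0 < x -> 0 < h x) ->
  log_convex_on [set x : R | M < x] h ->
  h (n%:R + 1) / h n%:R @[n --> \oo] --> (1 : R) ->
  forall x : R, 0 < x -> h (n%:R + x) / h n%:R @[n --> \oo] --> (1 : R).
Proof.
move=> M0 h0 hc h1 x x0.
pose d (n : nat) : R := ln (h n.+1%:R) - ln (h n%:R).
have d_cvg0 : d n @[n --> \oo] --> (0 : R).
  have : ln (h (n%:R + 1) / h n%:R) @[n --> \oo] --> ln (1 : R).
    apply: (@continuous_cvg _ _ _ _ _ _ (@ln R) 1 _ h1).
    exact: continuous_ln.
  rewrite ln1; apply: cvg_trans; apply: near_eq_cvg.
  (* Positivity of [h] is known only at positive arguments, so [n = 0] is left out. *)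
  exists 1%N => // n /= n1.
  by rewrite ln_div ?posrE ?h0 ?addr_gt0 ?ltr0n// /d natr1.
(* An integer beyond [x]: the right-hand unit chord starts at [n + 1 + N]. *)
pose N := Num.Def.archi_bound x.
have xN : x < N%:R by rewrite archi_boundP// ltW.
pose l (n : nat) : R := ln (h (n%:R + x)) - ln (h n%:R).
have l_cvg0 : l n @[n --> \oo] --> (0 : R).
  (* With base point [n + 1], the unit chord on its left starts at [n]. *)
  rewrite -cvg_shiftS /=.
  apply: (@squeeze_cvgr _ _ _ _ (fun n => x * d n)
      (fun n => x * d (n + (N + 1))%N)).
  - exists (Num.Def.archi_bound M) => // n /= Mn.
    have {}Mn : M < n%:R.
      by rewrite (lt_le_trans (archi_boundP M0))// ler_nat.
    have nS : n.+1%:R = n%:R + 1 :> R by rewrite natr1.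
    have eE : (n + (N + 1))%:R = n%:R + 1 + N%:R :> R.
      by rewrite !natrD; lra.
    have eS : (n + (N + 1)).+1%:R = n%:R + 1 + N%:R + 1 :> R.
      by rewrite -natr1 eE.
    rewrite /l /d eS eE nS.
    set a := n%:R + 1.
    have Ma : M < a by rewrite /a; lra.
    have s1 : (ln (h a) - ln (h n%:R)) / (a - n%:R) <=
              (ln (h (a + x)) - ln (h a)) / (a + x - a).
      by apply: (convex_slope_le hc); rewrite /a; lra.
    have s2 : (ln (h (a + x)) - ln (h a)) / (a + x - a) <=
      (ln (h (a + N%:R)) - ln (h (a + x))) / (a + N%:R - (a + x)).
      by apply: (convex_slope_le hc); lra.
    have s3 : (ln (h (a + N%:R)) - ln (h (a + x))) / (a + N%:R - (a + x)) <=
      (ln (h (a + N%:R + 1)) - ln (h (a + N%:R))) / (a + N%:R + 1 - (a + N%:R)).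
      by apply: (convex_slope_le hc); lra.
    have := le_trans s2 s3; move: s1.
    have -> : a - n%:R = 1 by rewrite /a; lra.
    have -> : a + x - a = x by lra.
    have -> : a + N%:R + 1 - (a + N%:R) = 1 by lra.
    rewrite !divr1 ler_pdivlMr// ler_pdivrMr// ![x * _]mulrC.
    by move=> -> ->.
  - by rewrite -(mulr0 x); apply: cvgMl_tmp.
  - rewrite -(mulr0 x); apply: cvgMl_tmp.
    by rewrite (cvg_shiftn (N + 1) d).
have : expR (l n) @[n --> \oo] --> (1 : R).
  rewrite -[X in _ --> X]expR0.
  by apply: continuous_cvg l_cvg0; exact: continuous_expR.
apply: cvg_trans; apply: near_eq_cvg.
exists 1%N => // n /= n1; rewrite /l expRB !lnK ?posrE ?h0 ?ltr0n//.
by rewrite addr_gt0// ltr0n.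
Qed.

(** * Convergence, positivity and shift of q-Pochhammer products *)

Section qPochhammer_theory.
Context {R : realType}.
Implicit Types a t : R.

Definition qPochhammer_partial a t (n : nat) : R :=
  \prod_(0 <= k < n) (1 - a * t ^+ k).

Local Notation P := qPochhammer_partial.

Lemma qPochhammer_partialS a t n : P a t n.+1 = P a t n * (1 - a * t ^+ n).
Proof. by rewrite /P big_nat_recr. Qed.

(** Follows from [1 + v <= expR v] at [v = u / (1 - a)], since [(1 - u) * (1 + v) = 1 + u * (a - u)
    / (1 - a)] is at least 1. *)
Lemma expR_le_onem a u : 0 <= u -> u <= a -> a < 1 ->
  expR (- (u / (1 - a))) <= 1 - u.
Proof.
move=> u0 ua a1; have a1_gt0 : 0 < 1 - a by lra.
have den0 : 0 < 1 + u / (1 - a) by rewrite ltr_wpDr ?divr_ge0// ltW.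
rewrite expRN; apply: (@le_trans _ _ (1 + u / (1 - a))^-1).
  by rewrite lef_pV2 ?posrE ?expR_gt0// expR_ge1Dx.
rewrite -div1r ler_pdivrMr//.
have -> : (1 - u) * (1 + u / (1 - a)) = 1 + u * (a - u) / (1 - a).
  by field; rewrite gt_eqF.
by rewrite lerDl divr_ge0 ?mulr_ge0 ?subr_ge0// ltW.
Qed.

Section bounded_parameters.
Context {a t : R}.
Hypotheses (a_ge0 : 0 <= a) (a_lt1 : a < 1) (t_gt0 : 0 < t) (t_lt1 : t < 1).

Lemma qPochhammer_term_bounds n : 0 <= a * t ^+ n <= a.
Proof.
rewrite mulr_ge0 ?exprn_ge0 ?(ltW t_gt0)//=.
by rewrite ler_piMr// exprn_ile1 ?ltW.
Qed.

Lemma qPochhammer_partial_gt0 n : 0 < P a t n.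
Proof.
apply: prodr_gt0 => k _; rewrite subr_gt0.
by case/andP: (qPochhammer_term_bounds k) => _ /le_lt_trans; exact.
Qed.

(* The exponents a t^k / (1 - a) sum geometrically, so the partial products
   stay above one fixed exponential; this is what makes the limit nonzero. *)
Lemma qPochhammer_partial_ge n :
  expR (- (a / (1 - a) / (1 - t) * (1 - t ^+ n))) <= P a t n.
Proof.
elim: n => [|n IH].
  by rewrite /P big_geq// expr0 subrr mulr0 oppr0 expR0.
rewrite qPochhammer_partialS.
have -> : - (a / (1 - a) / (1 - t) * (1 - t ^+ n.+1)) =
    - (a / (1 - a) / (1 - t) * (1 - t ^+ n)) + - (a * t ^+ n / (1 - a)).
  by rewrite exprS; field; apply/andP; split; rewrite gt_eqF// subr_gt0.
rewrite expRD ler_pM ?expR_ge0// expR_le_onem//.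
  by case/andP: (qPochhammer_term_bounds n).
by case/andP: (qPochhammer_term_bounds n).
Qed.

Lemma qPochhammer_partial_lbound n : expR (- (a / (1 - a) / (1 - t))) <= P a t n.
Proof.
apply: le_trans (qPochhammer_partial_ge n).
rewrite ler_expR lerN2 ler_piMr//.
  by rewrite !divr_ge0// subr_ge0 ltW.
by rewrite gerBl exprn_ge0 ?ltW.
Qed.

(** All factors lie in [[0, 1]], so the partial products decrease, and they are bounded below. *)
Lemma qPochhammer_cvg : P a t n @[n --> \oo] --> qPochhammer a t.
Proof.
apply: nonincreasing_is_cvgn.
  apply/nonincreasing_seqP => n; rewrite [leLHS]qPochhammer_partialS.
  rewrite ler_piMr ?(ltW (qPochhammer_partial_gt0 _))//.
  by case/andP: (qPochhammer_term_bounds n) => *; lra.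
exists (expR (- (a / (1 - a) / (1 - t)))) => _ [n _ <-].
exact: qPochhammer_partial_lbound.
Qed.

Lemma qPochhammer_gt0 : 0 < qPochhammer a t.
Proof.
apply: lt_le_trans (expR_gt0 (- (a / (1 - a) / (1 - t)))) _.
apply: limr_ge; first by apply/cvg_ex; eexists; exact: qPochhammer_cvg.
by apply: nearW => n; exact: qPochhammer_partial_lbound.
Qed.

End bounded_parameters.

(** Splits off the factor [k = 0]; this later links the parameters [p ^ y] and [p ^ (1 + y)]. *)
Lemma qPochhammer_rec a t : 0 <= a -> a < 1 -> 0 < t -> t < 1 ->
  qPochhammer a t = (1 - a) * qPochhammer (a * t) t.
Proof.
move=> a0 a1 t0 t1.
have at0 : 0 <= a * t by rewrite mulr_ge0// ltW.
have at1 : a * t < 1 by nra.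
apply: cvg_lim => //; rewrite -cvg_shiftS /=.
have -> : (fun n => \prod_(0 <= k < n.+1) (1 - a * t ^+ k)) =
    (fun n => (1 - a) * P (a * t) t n).
  apply/funext => n; rewrite /P big_nat_recl// expr0 mulr1; congr (_ * _).
  by apply: eq_bigr => k _; rewrite exprS mulrA.
by apply: cvgMl_tmp; exact: qPochhammer_cvg.
Qed.

End qPochhammer_theory.

Lemma powR_itv01 {R : realType} {p x : R} : 0 < p -> p < 1 -> 0 < x ->
  0 < p `^ x < 1.
Proof.
move=> p0 p1 x0; rewrite powR_gt0//= /powR gt_eqF// expR_lt1.
by rewrite pmulr_rlt0// ln_lt0// p0.
Qed.

(** * Solving the recursion for a base [0 < p < 1] *)

Section q_recursion.
Context {R : realType} {p y M : R} {h : R -> R}.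
Hypotheses (p_gt0 : 0 < p) (p_lt1 : p < 1) (y_gt0 : 0 < y).
Hypothesis h_gt0 : forall x : R, 0 < x -> 0 < h x.
Hypothesis h_rec : forall x : R, 0 < x ->
  h (x + 1) = (1 - p `^ x) / (1 - p `^ (x + y)) * h x.
Hypotheses (M_ge0 : 0 <= M) (h_convex : log_convex_on [set x : R | M < x] h).

Local Notation P := qPochhammer_partial.

Let powRp_bounds x : 0 < x -> [/\ 0 <= p `^ x, p `^ x < 1 & 0 < 1 - p `^ x].
Proof.
by move=> x0; have /andP[? ?] := powR_itv01 p_gt0 p_lt1 x0; split; lra.
Qed.

Let powRpDn x (n : nat) : p `^ (x + n%:R) = p `^ x * p ^+ n.
Proof.
have cond : (x + n%:R == 0) ==> (p != 0) by rewrite (gt_eqF p_gt0) implybT.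
by rewrite powRD// powR_mulrn// ltW.
Qed.

(** Each use of the recursion adds its denominator to the product on the left and its numerator to
    the one on the right. *)
Lemma q_recursion_iter x n : 0 < x ->
  h (x + n%:R) * P (p `^ (x + y)) p n = h x * P (p `^ x) p n.
Proof.
move=> x0; elim: n => [|n IH]; first by rewrite /P !big_geq// addr0.
have xn0 : 0 < x + n%:R by rewrite ltr_wpDr.
have [_ _ d0] := powRp_bounds (x + n%:R + y) (addr_gt0 xn0 y_gt0).
rewrite !qPochhammer_partialS -natr1 addrA h_rec// -!powRpDn.
rewrite [x + y + n%:R]addrAC.
rewrite [RHS]mulrA -IH; field.
by rewrite gt_eqF.
Qed.

(** By the recursion the ratio is [(1 - p ^ n) / (1 - p ^ y * p ^ n)], and [p ^ n] vanishes in the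
    limit. *)
Lemma q_recursion_ratio_cvg1 : h (n%:R + 1) / h n%:R @[n --> \oo] --> (1 : R).
Proof.
have pn0 : p ^+ n @[n --> \oo] --> (0 : R).
  by apply: cvg_expr; rewrite ger0_norm// ltW.
have : (1 - p ^+ n) / (1 - p `^ y * p ^+ n) @[n --> \oo] --> (1 : R).
  rewrite -[X in _ --> X](_ : (1 - 0) / (1 - p `^ y * 0) = 1); last first.
    by rewrite mulr0 subr0 divr1.
  apply: cvgM.
    by apply: cvgB; [exact: cvg_cst|exact: pn0].
  apply: cvgV; first by rewrite mulr0 subr0 oner_neq0.
  apply: cvgB; first exact: cvg_cst.
  by apply: cvgMl_tmp; exact: pn0.
apply: cvg_trans; apply: near_eq_cvg.
exists 1%N => // n /= n1; rewrite h_rec ?ltr0n// mulfK; last first.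
  by rewrite gt_eqF// h_gt0 ?ltr0n.
by rewrite [n%:R + y]addrC powRpDn powR_mulrn// ltW.
Qed.

Lemma q_recursion_solution x : 0 < x ->
  h x = h 1 * (qPochhammer p p * qPochhammer (p `^ (x + y)) p)
          / (qPochhammer (p `^ x) p * qPochhammer (p `^ (1 + y)) p).
Proof.
move=> x0.
have Pcvg z : 0 < z -> P (p `^ z) p n @[n --> \oo] --> qPochhammer (p `^ z) p.
  by move=> /powRp_bounds[? ? _]; exact: qPochhammer_cvg.
have Pgt0 z n : 0 < z -> 0 < P (p `^ z) p n.
  by move=> /powRp_bounds[? ? _]; exact: qPochhammer_partial_gt0.
have P_gt0 z : 0 < z -> 0 < qPochhammer (p `^ z) p.
  by move=> /powRp_bounds[? ? _]; exact: qPochhammer_gt0.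
have xy0 : 0 < x + y by rewrite addr_gt0.
have y10 : 0 < 1 + y by rewrite addr_gt0.
have pE : p `^ 1 = p by rewrite powRr1// ltW.
have shift_cvg1 z : 0 < z -> h (n%:R + z) / h n%:R @[n --> \oo] --> (1 : R).
  exact: log_convex_ratio_cvg1 M_ge0 h_gt0 h_convex q_recursion_ratio_cvg1 _.
(* The same sequence gets two limits: 1 by log-convexity here, and a q-Pochhammer quotient by
   iteration in [lim2]. Their equality determines [h x]. *)
have lim1 : (h (n%:R + x) / h n%:R) / (h (n%:R + 1) / h n%:R) @[n --> \oo]
    --> (1 / 1 : R).
  apply: cvgM; first exact: shift_cvg1.
  by apply: cvgV; [exact: oner_neq0|exact: shift_cvg1].
have lim2 : (h (n%:R + x) / h n%:R) / (h (n%:R + 1) / h n%:R) @[n --> \oo]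
    --> (h x * qPochhammer (p `^ x) p / qPochhammer (p `^ (x + y)) p)
      / (h 1 * qPochhammer (p `^ 1) p / qPochhammer (p `^ (1 + y)) p).
  have : (h x * P (p `^ x) p n / P (p `^ (x + y)) p n)
       / (h 1 * P (p `^ 1) p n / P (p `^ (1 + y)) p n) @[n --> \oo]
    --> (h x * qPochhammer (p `^ x) p / qPochhammer (p `^ (x + y)) p)
      / (h 1 * qPochhammer (p `^ 1) p / qPochhammer (p `^ (1 + y)) p).
    apply: cvgM; last apply: cvgV.
    - apply: cvgM; first by apply: cvgMl_tmp; exact: Pcvg.
      by apply: cvgV; [rewrite gt_eqF// P_gt0|exact: Pcvg].
    - by rewrite gt_eqF// divr_gt0 ?mulr_gt0 ?P_gt0 ?h_gt0.
    - apply: cvgM; first by apply: cvgMl_tmp; exact: Pcvg.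
      by apply: cvgV; [rewrite gt_eqF// P_gt0|exact: Pcvg].
  apply: cvg_trans; apply: near_eq_cvg.
  exists 1%N => // n /= n1.
  have n0 : 0 < n%:R :> R by rewrite ltr0n.
  (* Iterating from [x] and from [1] cancels all partial products. *)
  rewrite -!q_recursion_iter// ![_ + n%:R]addrC.
  field; do ?[apply/andP; split]; rewrite gt_eqF// ?h_gt0 ?Pgt0//.
have hx0 : h x != 0 by rewrite gt_eqF ?h_gt0.
have h10 : h 1 != 0 by rewrite gt_eqF ?h_gt0.
have ax0 : qPochhammer (p `^ x) p != 0 by rewrite gt_eqF ?P_gt0.
have axy0 : qPochhammer (p `^ (x + y)) p != 0 by rewrite gt_eqF ?P_gt0.
have ap0 : qPochhammer p p != 0 by rewrite gt_eqF// -{1}pE P_gt0.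
have ay0 : qPochhammer (p `^ (1 + y)) p != 0 by rewrite gt_eqF ?P_gt0.
have den0 : h 1 * qPochhammer p p / qPochhammer (p `^ (1 + y)) p != 0.
  by rewrite !mulf_neq0 ?invr_eq0.
have E1 : _ = 1 / 1 := cvg_unique (@Rhausdorff R) lim2 lim1.
have E : h x * qPochhammer (p `^ x) p / qPochhammer (p `^ (x + y)) p =
    h 1 * qPochhammer p p / qPochhammer (p `^ (1 + y)) p.
  by move: E1; rewrite pE divr1 => E1; rewrite -[LHS](divfK den0) E1 mul1r.
have -> : h x = h x * qPochhammer (p `^ x) p / qPochhammer (p `^ (x + y)) p
    * qPochhammer (p `^ (x + y)) p / qPochhammer (p `^ x) p.
  by field; rewrite ax0 axy0.
by rewrite E; field; rewrite ax0 ay0.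
Qed.

End q_recursion.

(** * Closed forms of the q-beta function on either side of [q = 1] *)

Section qBeta_closed_form.
Context {R : realType} {q y : R}.
Hypotheses (q_gt0 : 0 < q) (y_gt0 : 0 < y).

Lemma qBeta_lt1E x : q < 1 -> 0 < x ->
  qBeta q x y = (1 - q) * qPochhammer q q * qPochhammer (q `^ (x + y)) q
    / (qPochhammer (q `^ x) q * qPochhammer (q `^ y) q).
Proof.
move=> q1 x0; rewrite /qBeta /qGamma q1.
have P0 z : 0 < z -> qPochhammer (q `^ z) q != 0.
  move=> /(powR_itv01 q_gt0 q1)/andP[/ltW ? ?].
  by rewrite gt_eqF// qPochhammer_gt0.
have Pq0 : qPochhammer q q != 0 by rewrite -{1}(powRr1 (ltW q_gt0)) P0.
(* The exponents differ by exactly 1, so a single factor [1 - q] survives. *)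
have e : (1 - q) `^ (1 - x) * (1 - q) `^ (1 - y) =
    (1 - q) * (1 - q) `^ (1 - (x + y)).
  have d0 : 1 - q != 0 by rewrite subr_eq0 gt_eqF.
  rewrite -[X in _ = X * _]powRr1 ?subr_ge0 ?ltW//.
  by rewrite -!powRD ?d0 ?implybT//; congr (_ `^ _); lra.
have E0 : (1 - q) `^ (1 - (x + y)) != 0 by rewrite gt_eqF ?powR_gt0 ?subr_gt0.
move: (P0 _ x0) (P0 _ y_gt0) (P0 _ (addr_gt0 x0 y_gt0)) => Px Py Pxy.
transitivity ((1 - q) `^ (1 - x) * (1 - q) `^ (1 - y)
    / (1 - q) `^ (1 - (x + y)) * qPochhammer q q * qPochhammer (q `^ (x + y)) q
    / (qPochhammer (q `^ x) q * qPochhammer (q `^ y) q)).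
  by field; rewrite Px Py Pxy Pq0 E0.
by rewrite e; field; rewrite Px Py E0.
Qed.

Lemma qBeta_gt1E x : 1 < q -> 0 < x ->
  qBeta q x y = (q - 1) * q `^ (- (y * x)) *
    (qPochhammer q^-1 q^-1 * qPochhammer (q^-1 `^ (x + y)) q^-1
    / (qPochhammer (q^-1 `^ x) q^-1 * qPochhammer (q^-1 `^ y) q^-1)).
Proof.
move=> q1 x0; rewrite /qBeta /qGamma ltNge (ltW q1) /=.
have qV0 : 0 < q^-1 by rewrite invr_gt0.
have qV1 : q^-1 < 1 by rewrite invf_lt1.
have qVE z : q `^ (- z) = q^-1 `^ z.
  by rewrite -[q^-1]powR_inv1 ?ltW// -powRrM mulN1r.
rewrite (qVE x) (qVE y) (qVE (x + y)).
have P0 z : 0 < z -> qPochhammer (q^-1 `^ z) q^-1 != 0.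
  move=> /(powR_itv01 qV0 qV1)/andP[/ltW ? ?].
  by rewrite gt_eqF// qPochhammer_gt0.
have Pq0 : qPochhammer q^-1 q^-1 != 0 by rewrite -{1}(powRr1 (ltW qV0)) P0.
have q0 : q != 0 by rewrite gt_eqF.
have d0 : q - 1 != 0 by rewrite subr_eq0 gt_eqF.
have e : (q - 1) `^ (1 - x) * (q - 1) `^ (1 - y) =
    (q - 1) * (q - 1) `^ (1 - (x + y)).
  rewrite -[X in _ = X * _]powRr1 ?subr_ge0 ?ltW//.
  by rewrite -!powRD ?d0 ?implybT//; congr (_ `^ _); lra.
(* The quadratic exponents fail to add up by the cross term [x * y], the source of the factor
   [q ^ (- (y * x))]. *)
have e' : q `^ (x * (x - 1) / 2) * q `^ (y * (y - 1) / 2) =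
    q `^ (- (y * x)) * q `^ ((x + y) * (x + y - 1) / 2).
  by rewrite -!powRD ?q0 ?implybT//; congr (_ `^ _); lra.
have E0 : (q - 1) `^ (1 - (x + y)) != 0 by rewrite gt_eqF ?powR_gt0 ?subr_gt0.
have E0' : q `^ ((x + y) * (x + y - 1) / 2) != 0 by rewrite gt_eqF ?powR_gt0.
move: (P0 _ x0) (P0 _ y_gt0) (P0 _ (addr_gt0 x0 y_gt0)) => Px Py Pxy.
transitivity ((q - 1) `^ (1 - x) * (q - 1) `^ (1 - y)
    / (q - 1) `^ (1 - (x + y)) *
    (q `^ (x * (x - 1) / 2) * q `^ (y * (y - 1) / 2)
    / q `^ ((x + y) * (x + y - 1) / 2)) *
    (qPochhammer q^-1 q^-1 * qPochhammer (q^-1 `^ (x + y)) q^-1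
    / (qPochhammer (q^-1 `^ x) q^-1 * qPochhammer (q^-1 `^ y) q^-1))).
  by field; rewrite Px Py Pxy Pq0 E0 E0'.
by rewrite e e'; congr (_ * _); field; rewrite E0 E0'.
Qed.

End qBeta_closed_form.

Theorem theorem6p3 (R : realType) (q y : R) (q_gt0 : 0 < q) (q_neq1 : q != 1)
  (y_gt0 : 0 < y) (f : R -> R)
  (f_gt0 : forall x : R, 0 < x -> 0 < f x)
  (f_rec : forall x : R, 0 < x ->
     f (x + 1) = (1 - q `^ x) / (1 - q `^ (x + y)) * f x)
  (f_logconvex : exists M : R, 0 <= M /\ log_convex_on [set x : R | M < x] f)
  (f_at1 : f 1 = (1 - q) / (1 - q `^ y)) :
  forall x : R, 0 < x -> f x = qBeta q x y.
Proof.
move=> x x0; have [M [M0 fc]] := f_logconvex.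
(* Serves both cases, with [p = q] and with [p = 1 / q]. *)
have recP p : 0 < p -> p < 1 -> [/\ 1 - p `^ y != 0,
    qPochhammer (p `^ x) p != 0, qPochhammer (p `^ (1 + y)) p != 0 &
    qPochhammer (p `^ y) p = (1 - p `^ y) * qPochhammer (p `^ (1 + y)) p].
  move=> p0 p1.
  have /andP[/ltW y0 y1] := powR_itv01 p0 p1 y_gt0.
  have /andP[/ltW u0 u1] := powR_itv01 p0 p1 x0.
  have /andP[/ltW v0 v1] := powR_itv01 p0 p1 (addr_gt0 ltr01 y_gt0).
  split; rewrite ?gt_eqF ?subr_gt0 ?qPochhammer_gt0//.
  rewrite qPochhammer_rec// [1 + y]addrC powRD ?powRr1 ?(ltW p0)//.
  by rewrite (gt_eqF p0) implybT.
have [q1|q1] := ltP q 1.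
  have [d0 Px P1y Py] := recP q q_gt0 q1.
  rewrite (qBeta_lt1E q_gt0 y_gt0)//.
  rewrite (q_recursion_solution q_gt0 q1 y_gt0 f_gt0 f_rec M0 fc _ x0) f_at1 Py.
  by field; rewrite d0 Px P1y.
have {}q1 : 1 < q by rewrite lt_neqAle eq_sym q_neq1.
have qV0 : 0 < q^-1 by rewrite invr_gt0.
have qV1 : q^-1 < 1 by rewrite invf_lt1.
have q0 : q != 0 by rewrite gt_eqF.
have qVE z : q^-1 `^ z = (q `^ z)^-1.
  by rewrite -powRN -[q^-1]powR_inv1 ?ltW// -powRrM mulN1r.
have qz0 z : q `^ z != 0 by rewrite gt_eqF ?powR_gt0.
have qz1 z : 0 < z -> q `^ z != 1.
  move=> /(powR_itv01 qV0 qV1)/andP[_]; rewrite qVE.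
  by apply: contraTneq => ->; rewrite invr1 ltxx.
(* Replacing [q] by [1 / q] in the recursion multiplies its coefficient by [q ^ y], which is the
   growth of [q ^ (y * z)] under [z + 1]. *)
pose h z := f z * q `^ (y * z).
have h_gt0 z : 0 < z -> 0 < h z.
  by move=> z0; rewrite mulr_gt0 ?powR_gt0 ?f_gt0.
have h_rec z : 0 < z ->
    h (z + 1) = (1 - q^-1 `^ z) / (1 - q^-1 `^ (z + y)) * h z.
  move=> z0; have := qz1 _ (addr_gt0 z0 y_gt0).
  rewrite /h f_rec// !qVE mulrDr mulr1 !powRD ?q0 ?implybT// => zy1.
  by field; rewrite !qz0 !subr_eq0 zy1 eq_sym zy1.
have hc : log_convex_on [set z : R | M < z] h.
  apply: log_convex_on_mul_powR => // z Mz.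
  by rewrite f_gt0// (le_lt_trans M0).
have [d0 Px P1y Py] := recP _ qV0 qV1.
(* Undoing the twist produces exactly the power of [q] in [qBeta_gt1E]. *)
have fE : f x = h x * q `^ (- (y * x)) by rewrite /h powRN mulfK.
have h1 : h 1 = (q - 1) / (1 - q^-1 `^ y).
  rewrite /h f_at1 mulr1 qVE; have := qz1 _ y_gt0 => y1.
  by field; rewrite qz0 !subr_eq0 y1 eq_sym y1.
rewrite (qBeta_gt1E q_gt0 y_gt0)// fE.
rewrite (q_recursion_solution qV0 qV1 y_gt0 h_gt0 h_rec M0 hc _ x0) h1 Py.
by field; rewrite d0 Px P1y.
Qed.
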